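(* Let $\varepsilon > 0$ and let $G$ be a finite abelian group. If $A \subseteq G$ has at least $\left(\frac{1}{3} + \varepsilon\right)|G|$ elements and $\mathrm{ST}(A) \le \varepsilon^2 |G|^2 / 2$, then $A$ contains a sum-free set $B$ with $|A \setminus B| \le \varepsilon |G|$.
   Context: For a subset $A$ of a finite abelian group, $\mathrm{ST}(A) = |\{(x,y,z) \in A^3 : x+y=z\}|$ is the number of (ordered) Schur triples contained in $A$ (elements not necessarily distinct). A set is sum-free if it contains no $x,y,z$ (not necessarily distinct) with $x+y=z$. *)

(* Defs.v *)
From mathcomp Require Import all_boot all_order all_algebra.

Set Implicit Arguments.
Unset Strict Implicit.
Unset Printing Implicit Defensive.

Import GRing.Theory.
Local Open Scope ring_scope.

Definition schur_triples (G : finZmodType) (A : {set G}) : {set G * G * G} :=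
  [set t : G * G * G |
    [&& t.1.1 \in A, t.1.2 \in A, t.2 \in A & t.1.1 + t.1.2 == t.2]].

Definition ST (G : finZmodType) (A : {set G}) : nat := #|schur_triples A|.

Definition sum_free (G : finZmodType) (B : {set G}) : Prop :=
  forall x y z : G, x \in B -> y \in B -> z \in B -> x + y <> z.

(* Main.v *)
Require Import Defs.
From mathcomp Require Import all_boot all_order all_algebra.
From mathcomp Require Import reals.
From mathcomp Require Import lra.

(** Keep in [B] the [x] of [A] that are the first term of fewer than [eps n / 2]
    Schur triples of [A], where [n] is the order of [G].  The triples are
    counted by their first term ([ST_sum]), so, by Markov's inequality, the
    bound [eps ^ 2 n ^ 2 / 2] on their number leaves out at most [eps n]
    elements of [A].

    If [x], [y] and [x + y] were all in [B], the translates [A], [A - x] and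
    [A - (x + y)] would pairwise meet in fewer than [eps n / 2] points, because
    the number of Schur triples starting with [u] is the size of the meet of
    [A] and [A - u].  But these three sets have total size at least
    [n + 3 eps n] inside a group of order [n], so the sizes of their pairwise
    meets add up to at least [3 eps n] ([card_three_translates]). *)

Local Open Scope ring_scope.
Import Order.TTheory GRing.Theory Num.Theory.

Definition completions {G : finZmodType} (A : {set G}) (x : G) : {set G} :=
  [set y in A | x + y \in A].

Lemma card_sum_mem {T : finType} (A : {set T}) :
  #|A| = (\sum_(g : T) (g \in A))%N.
Proof. by rewrite -sum1_card big_mkcond. Qed.

Lemma card_sum_translate {G : finZmodType} (A : {set G}) (x : G) :
  #|A| = (\sum_(g : G) ((x + g)%R \in A))%N.
Proof. by rewrite card_sum_mem (reindex_inj (addrI x)). Qed.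

Lemma ST_sum {G : finZmodType} (A : {set G}) :
  ST A = (\sum_(x in A) #|completions A x|)%N.
Proof.
rewrite /ST card_sum_mem [RHS]big_mkcond /=.
transitivity (\sum_x \sum_y \sum_z ((x, y, z) \in schur_triples A))%N.
  by rewrite !pair_bigA; apply: eq_bigr => -[[]].
apply: eq_bigr => x _; case: ifP => xA; last first.
  by rewrite big1 // => y _; rewrite big1 // => z _; rewrite inE /= xA.
rewrite card_sum_mem; apply: eq_bigr => y _.
(* The third term is determined by the first two. *)
rewrite (bigD1 (x + y)) //= big1 => [|z zxy].
  by rewrite !inE /= xA eqxx andbT addn0.
by rewrite inE /= eq_sym (negPf zxy) !andbF.
Qed.

(** A point lying in [k] of the translates [A], [A - x], [A - (x + y)] lies in
    at least [k - 1] of their pairwise meets.  The meet of the last two is the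
    translate by [- x] of the meet of [A] and [A - y]. *)
Lemma card_three_translates {G : finZmodType} (A : {set G}) (x y : G) :
  (3 * #|A| <= #|G| + (#|completions A x| + #|completions A y|
                       + #|completions A (x + y)%R|))%N.
Proof.
rewrite !mulSn mul0n addn0 {1}(card_sum_mem A) {1}(card_sum_translate A x).
rewrite {1}(card_sum_translate A (x + y)).
rewrite (card_sum_mem (completions A x)) (card_sum_translate (completions A y) x).
rewrite (card_sum_mem (completions A (x + y))) -sum1_card -!big_split /=.
apply: leq_sum => g _; rewrite !inE addrA (addrC y x).
by case: (g \in A); case: (x + g \in A); case: (x + y + g \in A).
Qed.

Theorem proposition1p8 (R : realType) (eps : R) (G : finZmodType)
    (A : {set G}) (heps : 0 < eps)
    (hA : (3%:R^-1 + eps) * (#|G|)%:R <= (#|A|)%:R)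
    (hST : (ST A)%:R <= eps ^+ 2 * (#|G|)%:R ^+ 2 / 2%:R) :
  exists B : {set G},
    [/\ B \subset A, sum_free B & (#|A :\: B|)%:R <= eps * (#|G|)%:R].
Proof.
have n_gt0 : 0 < #|G|%:R :> R by rewrite ltr0n; apply/card_gt0P; exists 0.
have en_gt0 : 0 < eps * #|G|%:R by exact: mulr_gt0.
pose B := [set x in A | #|completions A x|%:R < eps * #|G|%:R / 2%:R].
exists B; split.
- by apply/subsetP => x; rewrite inE => /andP[].
- move=> x y z; rewrite !inE => /andP[_ hx] /andP[_ hy] /andP[_ hz] xyz.
  move: hz; rewrite -xyz => hz.
  have := card_three_translates A x y.
  by rewrite -(ler_nat R) natrM !natrD => h; lra.
- have markov : #|A :\: B|%:R * (eps * #|G|%:R / 2%:R) <= (ST A)%:R.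
    rewrite ST_sum natr_sum (big_setID B) /= -[leLHS]add0r.
    apply: lerD; first by apply: sumr_ge0.
    rewrite mulr_natl -sumr_const; apply: ler_sum => x.
    by rewrite !inE => /andP[+ xA]; rewrite xA /= -leNgt.
  have half_gt0 : 0 < eps * #|G|%:R / 2%:R by rewrite divr_gt0.
  rewrite -(ler_pM2r half_gt0); apply: le_trans markov (le_trans hST _).
  by rewrite -exprMn expr2 [leRHS]mulrA.
Qed.
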